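(* Let $\theta$ be a congruence relation on a weakly dicomplemented lattice $L$. Then: (1) $F=[1]_{\theta}$ is a normal filter of $L$ and $I=[0]_{\theta}$ is a normal ideal of $L$. Moreover, $\Psi(I)=F$ and $\Phi(F)=I$. (2) $\theta_{\mid S(L)}\in \mathrm{Con}(S(L))$ and $\theta_{\mid \overline{S}(L)}\in \mathrm{Con}(\overline{S}(L))$. (3) (i) If $(0,1)\in\theta$, then $\theta=L^{2}$. (ii) If $S(L)=\overline{S}(L)=\{0,1\}$, then either $\theta=L^{2}$, or $[0]_{\theta}=\{0\}$ and $[1]_{\theta}=\{1\}$. (4) If $G=[1]_{\theta}\cap\overline{S}(L)$, then $[1]_{\theta}=N[G)$. (5) $[1]_{\theta}=\{1\}$ if and only if $[0]_{\theta}=\{0\}$.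
   Context: A weakly dicomplemented lattice (WDL) is an algebra $(L;\wedge,\vee,{}^{\Delta},{}^{\nabla},0,1)$ of type $(2,2,1,1,0,0)$ such that $(L;\wedge,\vee,0,1)$ is a bounded lattice and for all $x,y\in L$: $x^{\Delta\Delta}\le x$; $x\le y\Rightarrow y^{\Delta}\le x^{\Delta}$; $(x\wedge y)\vee(x\wedge y^{\Delta})=x$; $x^{\nabla\nabla}\ge x$; $x\le y\Rightarrow y^{\nabla}\le x^{\nabla}$; $(x\vee y)\wedge(x\vee y^{\nabla})=x$. Exponents are applied from left to right: $x^{\Delta\nabla}=(x^{\Delta})^{\nabla}$, $x^{\nabla\Delta}=(x^{\nabla})^{\Delta}$. A congruence is an equivalence relation compatible with $\wedge,\vee,{}^{\Delta},{}^{\nabla}$; $[a]_{\theta}=\{x\in L\mid (a,x)\in\theta\}$; $\theta_{\mid S}=\theta\cap S^{2}$. A filter of $L$ is a nonempty upward closed subset closed under $\wedge$; an ideal is defined dually ($L$ itself is allowed). A filter $F$ is normal if $x\in F\Rightarrow x^{\Delta\nabla}\in F$; an ideal $I$ is normal if $x\in I\Rightarrow x^{\nabla\Delta}\in I$. $N[G)$ is the least normal filter of $L$ containing $G$. For a normal ideal $I$, $\Psi(I)=\{z\in L\mid z\ge x^{\Delta}\text{ for some }x\in I\}$; for a normal filter $F$, $\Phi(F)=\{z\in L\mid z\le x^{\nabla}\text{ for some }x\in F\}$. The skeleton is $S(L)=\{x\in L\mid x^{\nabla\nabla}=x\}$, regarded as the ortholattice $(S(L);\wedge,\sqcup,{}^{\nabla},0,1)$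 with $x\sqcup y=(x^{\nabla}\wedge y^{\nabla})^{\nabla}$; the dual skeleton is $\overline{S}(L)=\{x\in L\mid x^{\Delta\Delta}=x\}$, regarded as the ortholattice $(\overline{S}(L);\overline{\sqcap},\vee,{}^{\Delta},0,1)$ with $x\,\overline{\sqcap}\,y=(x^{\Delta}\vee y^{\Delta})^{\Delta}$. $\mathrm{Con}$ denotes the set of congruences of these algebras. *)

(* Defs.v *)
From HB Require Import structures.
From Corelib Require Export RelationClasses.
From mathcomp Require Export all_boot all_order.
From mathcomp Require Export boolp classical_sets.

Set Implicit Arguments.
Unset Strict Implicit.
Unset Printing Implicit Defensive.

Import Order.TTheory.
Local Open Scope classical_set_scope.
Local Open Scope order_scope.

Reserved Notation "x ^Δ" (at level 1, left associativity, format "x ^Δ").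
Reserved Notation "x ^∇" (at level 1, left associativity, format "x ^∇").

HB.mixin Record isWeaklyDicomplemented d L of Order.TBLattice d L := {
  dcompl : L -> L;
  ncompl : L -> L;
  dcomplK_le : forall x : L, dcompl (dcompl x) <= x;
  dcompl_anti : forall x y : L, x <= y -> dcompl y <= dcompl x;
  dcompl_split : forall x y : L, (x `&` y) `|` (x `&` dcompl y) = x;
  ncomplK_ge : forall x : L, x <= ncompl (ncompl x);
  ncompl_anti : forall x y : L, x <= y -> ncompl y <= ncompl x;
  ncompl_split : forall x y : L, (x `|` y) `&` (x `|` ncompl y) = x
}.

#[short(type="wdLatticeType")]
HB.structure Definition WDLattice d :=
  { L of isWeaklyDicomplemented d L & Order.TBLattice d L }.

Notation "x ^Δ" := (dcompl x) : order_scope.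
Notation "x ^∇" := (ncompl x) : order_scope.

HB.mixin Record isOrtholattice d T of Order.TBLattice d T := {
  ortho : T -> T;
  orthoK : involutive ortho;
  ortho_anti : forall x y : T, x <= y -> ortho y <= ortho x;
  meet_ortho : forall x : T, x `&` ortho x = \bot;
  join_ortho : forall x : T, x `|` ortho x = \top
}.

#[short(type="ortholatticeType")]
HB.structure Definition Ortholattice d :=
  { T of isOrtholattice d T & Order.TBLattice d T }.

Record lattice_congruence d (L : latticeType d) (R : set (L * L)) : Prop := {
  cong_equiv : Equivalence (fun x y => R (x, y));
  cong_meet : forall x y x' y' : L,
    R (x, x') -> R (y, y') -> R (x `&` y, x' `&` y');
  cong_join : forall x y x' y' : L,
    R (x, x') -> R (y, y') -> R (x `|` y, x' `|` y')
}.

Record wd_congruence d (L : wdLatticeType d) (R : set (L * L)) : Prop := {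
  wd_cong_lattice : lattice_congruence R;
  wd_cong_dcompl : forall x x' : L, R (x, x') -> R (x^Δ, x'^Δ);
  wd_cong_ncompl : forall x x' : L, R (x, x') -> R (x^∇, x'^∇)
}.

Record ortho_congruence d (T : ortholatticeType d) (R : set (T * T)) : Prop := {
  ortho_cong_lattice : lattice_congruence R;
  ortho_cong_ortho : forall x x' : T, R (x, x') -> R (ortho x, ortho x')
}.

Definition cong_class (T : Type) (R : set (T * T)) (a : T) : set T :=
  [set x | R (a, x)].

Record lattice_filter d (L : latticeType d) (F : set L) : Prop := {
  filter_neq0 : F !=set0;
  filter_up : forall x y : L, F x -> x <= y -> F y;
  filter_meet : forall x y : L, F x -> F y -> F (x `&` y)
}.

Record lattice_ideal d (L : latticeType d) (I : set L) : Prop := {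
  ideal_neq0 : I !=set0;
  ideal_down : forall x y : L, I x -> y <= x -> I y;
  ideal_join : forall x y : L, I x -> I y -> I (x `|` y)
}.

Section NormalFiltersIdeals.
Context d (L : wdLatticeType d).
Implicit Types (x y : L) (F I G : set L).

Definition normal_filter F : Prop :=
  lattice_filter F /\ forall x, F x -> F (x^Δ^∇).

Definition normal_ideal I : Prop :=
  lattice_ideal I /\ forall x, I x -> I (x^∇^Δ).

Definition gen_normal_filter G : set L := smallest normal_filter G.

(* Only meaningful on normal ideals, resp. normal filters. *)
Definition Psi I : set L := [set z | exists2 x, I x & x^Δ <= z].
Definition Phi F : set L := [set z | exists2 x, F x & z <= x^∇].

Definition skeleton : set L := [set x | x^∇^∇ = x].
Definition dual_skeleton : set L := [set x | x^Δ^Δ = x].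

End NormalFiltersIdeals.

Arguments skeleton {d} L.
Arguments dual_skeleton {d} L.

Section WDTheory.
Context d (L : wdLatticeType d).
Implicit Types x y : L.

Lemma ncomplKK x : x^∇^∇^∇ = x^∇.
Proof.
by apply/le_anti; rewrite ncomplK_ge andbT; apply/ncompl_anti/ncomplK_ge.
Qed.

Lemma meet_ncompl x : x `&` x^∇ = \bot.
Proof. by have := ncompl_split \bot x; rewrite !join0x. Qed.

Lemma ncompl1 : \top^∇ = \bot :> L.
Proof. by rewrite -[LHS]meet1x meet_ncompl. Qed.

Lemma ncompl0 : \bot^∇ = \top :> L.
Proof. by apply/le_anti; rewrite lex1 -{1}ncompl1 ncomplK_ge. Qed.

Lemma dcomplKK x : x^Δ^Δ^Δ = x^Δ.
Proof.
by apply/le_anti; rewrite dcomplK_le /=; apply/dcompl_anti/dcomplK_le.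
Qed.

Lemma join_dcompl x : x `|` x^Δ = \top.
Proof. by have := dcompl_split \top x; rewrite !meet1x. Qed.

Lemma dcompl0 : \bot^Δ = \top :> L.
Proof. by rewrite -[LHS]join0x join_dcompl. Qed.

Lemma dcompl1 : \top^Δ = \bot :> L.
Proof. by apply/le_anti; rewrite le0x andbT -{1}dcompl0 dcomplK_le. Qed.

Lemma skel_ncompl x : x^∇ \in skeleton L.
Proof. by rewrite in_setE /skeleton /= ncomplKK. Qed.

Lemma skel_meet x y :
  x \in skeleton L -> y \in skeleton L -> x `&` y \in skeleton L.
Proof.
rewrite !in_setE /skeleton /= => sx sy.
apply/le_anti; rewrite ncomplK_ge andbT lexI -{2}sx -{3}sy.
by rewrite !(ncompl_anti, leIl, leIr).
Qed.

Lemma skel0 : \bot \in skeleton L.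
Proof. by rewrite -ncompl1 skel_ncompl. Qed.

Lemma skel1 : \top \in skeleton L.
Proof. by rewrite -ncompl0 skel_ncompl. Qed.

Lemma dskel_dcompl x : x^Δ \in dual_skeleton L.
Proof. by rewrite in_setE /dual_skeleton /= dcomplKK. Qed.

Lemma dskel_join x y :
  x \in dual_skeleton L -> y \in dual_skeleton L -> x `|` y \in dual_skeleton L.
Proof.
rewrite !in_setE /dual_skeleton /= => sx sy.
apply/le_anti; rewrite dcomplK_le leUx -{1}sx -{2}sy.
by rewrite !(dcompl_anti, leUl, leUr).
Qed.

Lemma dskel0 : \bot \in dual_skeleton L.
Proof. by rewrite -dcompl1 dskel_dcompl. Qed.

Lemma dskel1 : \top \in dual_skeleton L.
Proof. by rewrite -dcompl0 dskel_dcompl. Qed.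

Lemma gen_normal_filterP (G : set L) : normal_filter (gen_normal_filter G).
Proof.
split; first split.
- by exists \top => F [[[[x Fx] Fup _] _] _]; apply: Fup Fx (lex1 x).
- by move=> x y Nx xy F HF; case: (HF) => -[[_ Fup _] _] _; apply: Fup xy; exact: Nx.
- move=> x y Nx Ny F HF; case: (HF) => -[[_ _ FI] _] _.
  by apply: FI; [exact: Nx|exact: Ny].
- by move=> x Nx F HF; case: (HF) => -[_ FN] _; apply: FN; exact: Nx.
Qed.

End WDTheory.

(* The skeletons as ortholattices, ordered as subsets of L; they are not
   sublattices of L: see val_skel_join and val_dskel_meet. *)

Section Skeleton.
Context d (L : wdLatticeType d).

Definition skel_type : Type := {x : L | x \in skeleton L}.

HB.instance Definition _ := SubChoice.on skel_type.
HB.instance Definition _ := [SubChoice_isSubPOrder of skel_type by <: with d].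

Definition Skel z (sz : z \in skeleton L) : skel_type :=
  exist (fun z : L => z \in skeleton L) z sz.

Implicit Types x y z : skel_type.

Definition skel_ortho x : skel_type := Skel (skel_ncompl (val x)).

Definition skel_meet_op x y : skel_type :=
  Skel (skel_meet (valP x) (valP y)).

Definition skel_join_op x y : skel_type :=
  Skel (skel_ncompl ((val x)^∇ `&` (val y)^∇)).

Lemma skelE x : (val x)^∇^∇ = val x.
Proof. by have := valP x; rewrite in_setE. Qed.

Fact skel_meetP x y z : (x <= skel_meet_op y z) = (x <= y) && (x <= z).
Proof. exact: lexI. Qed.

Fact skel_joinP x y z : (skel_join_op x y <= z) = (x <= z) && (y <= z).
Proof.
rewrite -!Order.le_val /=; apply/idP/andP => [h|[xz yz]].
  by split; rewrite -[leLHS]skelE; apply: le_trans h;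
    apply: ncompl_anti; rewrite (leIl, leIr).
by rewrite -(skelE z); apply: ncompl_anti; rewrite lexI !ncompl_anti.
Qed.

HB.instance Definition _ :=
  Order.POrder_MeetJoin_isLattice.Build d skel_type skel_meetP skel_joinP.
HB.instance Definition _ :=
  @Order.hasBottom.Build d skel_type (Skel (skel0 L)) (fun x => le0x (val x)).
HB.instance Definition _ :=
  @Order.hasTop.Build d skel_type (Skel (skel1 L)) (fun x => lex1 (val x)).

Fact skel_orthoK : involutive skel_ortho.
Proof. by move=> x; apply/val_inj/skelE. Qed.

Fact skel_ortho_anti x y : x <= y -> skel_ortho y <= skel_ortho x.
Proof. exact: ncompl_anti. Qed.

Fact skel_meet_ortho x : x `&` skel_ortho x = \bot.
Proof. by apply/val_inj/meet_ncompl. Qed.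

Fact skel_join_ortho x : x `|` skel_ortho x = \top.
Proof.
by apply: val_inj; rewrite /= [X in X^∇]meet_ncompl; exact: ncompl0.
Qed.

HB.instance Definition _ := isOrtholattice.Build d skel_type
  skel_orthoK skel_ortho_anti skel_meet_ortho skel_join_ortho.

Lemma val_skel_meet x y : val (x `&` y) = val x `&` val y.
Proof. by []. Qed.

Lemma val_skel_join x y : val (x `|` y) = ((val x)^∇ `&` (val y)^∇)^∇.
Proof. by []. Qed.

Lemma val_skel_ortho x : val (ortho x) = (val x)^∇.
Proof. by []. Qed.

Definition skel_restr (R : set (L * L)) : set (skel_type * skel_type) :=
  [set p | R (val p.1, val p.2)].

End Skeleton.

Section DualSkeleton.
Context d (L : wdLatticeType d).

Definition dskel_type : Type := {x : L | x \in dual_skeleton L}.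

HB.instance Definition _ := SubChoice.on dskel_type.
HB.instance Definition _ := [SubChoice_isSubPOrder of dskel_type by <: with d].

Definition DSkel z (sz : z \in dual_skeleton L) : dskel_type :=
  exist (fun z : L => z \in dual_skeleton L) z sz.

Implicit Types x y z : dskel_type.

Definition dskel_ortho x : dskel_type := DSkel (dskel_dcompl (val x)).

Definition dskel_meet_op x y : dskel_type :=
  DSkel (dskel_dcompl ((val x)^Δ `|` (val y)^Δ)).

Definition dskel_join_op x y : dskel_type :=
  DSkel (dskel_join (valP x) (valP y)).

Lemma dskelE x : (val x)^Δ^Δ = val x.
Proof. by have := valP x; rewrite in_setE. Qed.

Fact dskel_meetP x y z : (x <= dskel_meet_op y z) = (x <= y) && (x <= z).
Proof.
rewrite -!Order.le_val /=; apply/idP/andP => [h|[xy xz]].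
  by split; rewrite -[leRHS]dskelE; apply: (le_trans h);
    apply: dcompl_anti; rewrite (leUl, leUr).
by rewrite -(dskelE x); apply: dcompl_anti; rewrite leUx !dcompl_anti.
Qed.

Fact dskel_joinP x y z : (dskel_join_op x y <= z) = (x <= z) && (y <= z).
Proof. exact: leUx. Qed.

HB.instance Definition _ :=
  Order.POrder_MeetJoin_isLattice.Build d dskel_type dskel_meetP dskel_joinP.
HB.instance Definition _ :=
  @Order.hasBottom.Build d dskel_type (DSkel (dskel0 L)) (fun x => le0x (val x)).
HB.instance Definition _ :=
  @Order.hasTop.Build d dskel_type (DSkel (dskel1 L)) (fun x => lex1 (val x)).

Fact dskel_orthoK : involutive dskel_ortho.
Proof. by move=> x; apply/val_inj/dskelE. Qed.

Fact dskel_ortho_anti x y : x <= y -> dskel_ortho y <= dskel_ortho x.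
Proof. exact: dcompl_anti. Qed.

Fact dskel_meet_ortho x : x `&` dskel_ortho x = \bot.
Proof.
by apply: val_inj; rewrite /= [X in X^Δ]join_dcompl; exact: dcompl1.
Qed.

Fact dskel_join_ortho x : x `|` dskel_ortho x = \top.
Proof. by apply/val_inj/join_dcompl. Qed.

HB.instance Definition _ := isOrtholattice.Build d dskel_type
  dskel_orthoK dskel_ortho_anti dskel_meet_ortho dskel_join_ortho.

Lemma val_dskel_meet x y : val (x `&` y) = ((val x)^Δ `|` (val y)^Δ)^Δ.
Proof. by []. Qed.

Lemma val_dskel_join x y : val (x `|` y) = val x `|` val y.
Proof. by []. Qed.

Lemma val_dskel_ortho x : val (ortho x) = (val x)^Δ.
Proof. by []. Qed.

Definition dskel_restr (R : set (L * L)) : set (dskel_type * dskel_type) :=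
  [set p | R (val p.1, val p.2)].

End DualSkeleton.

(* Main.v *)
Require Import Defs.

(** A congruence commutes with both complementations and these exchange [\bot]
    and [\top], so each of [^Δ], [^∇] maps the class of [\bot] into the class of
    [\top] and conversely (lemmas [cong_top_dcompl] to [cong_bot_ncompl]).
    Everything about these two classes comes from this exchange together with
    [x^Δ^Δ <= x <= x^∇^∇]:
    - normality holds because two successive complementations bring each class
      back into itself;
    - an element [x] of the class [F] of [\top] lies above [x^Δ^Δ], where [x^Δ]
      is in the class [I] of [\bot]. This gives [Psi I = F] and, since [x^Δ^Δ]
      is also in the dual skeleton and in [F], it shows that [F] is generated,
      as a filter, by its trace on the dual skeleton. Dually [Phi F = I].

    As [Psi] and [Phi] exchange the trivial ideal and the trivial filter, one
    of [F], [I] is trivial exactly when the other is. When the skeleton is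
    [{\bot, \top}], an element [x] of [I] satisfies [x <= x^∇^∇], with [x^∇^∇]
    in [I] and in the skeleton: either it is [\bot], so that [x = \bot], or
    [\bot] and [\top] are congruent, and then any [y], being the meet of [y]
    and [\top], is congruent to the meet of [y] and [\bot], that is to [\bot]:
    the congruence is total.

    Finally, the operations of the skeletons are terms in the operations of the
    algebra, so congruences restrict to them. *)

Set Implicit Arguments.
Unset Strict Implicit.
Unset Printing Implicit Defensive.

Import Order.TTheory.
Local Open Scope order_scope.
Local Open Scope classical_set_scope.

Section ComplementsAtBounds.
Local Open Scope order_scope.
Context d (L : wdLatticeType d).

Lemma Psi_bot : Psi [set \bot : L] = [set \top].
Proof.
apply/seteqP; split=> z /=.
  by case=> x ->; rewrite dcompl0 le1x => /eqP.
by move=> ->; exists \bot; rewrite // dcompl0.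
Qed.

Lemma Phi_top : Phi [set \top : L] = [set \bot].
Proof.
apply/seteqP; split=> z /=.
  by case=> x ->; rewrite ncompl1 lex0 => /eqP.
by move=> ->; exists \top; rewrite // ncompl1.
Qed.

End ComplementsAtBounds.

Section LatticeCongruence.
Local Open Scope order_scope.
Context d (L : tbLatticeType d) (theta : set (L * L)).
Hypothesis Htheta : lattice_congruence theta.
Implicit Types x y : L.

Lemma cong_refl x : theta (x, x).
Proof. by case: Htheta => -[]. Qed.

Lemma cong_class_top_filter : lattice_filter (cong_class theta \top).
Proof.
split=> [|x y tx xy|x y tx ty]; rewrite /cong_class /=.
- by exists \top; apply: cong_refl.
- by have := cong_join Htheta tx (cong_refl y); rewrite join1x join_r.
- by have := cong_meet Htheta tx ty; rewrite meet1x.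
Qed.

Lemma cong_class_bot_ideal : lattice_ideal (cong_class theta \bot).
Proof.
split=> [|x y tx yx|x y tx ty]; rewrite /cong_class /=.
- by exists \bot; apply: cong_refl.
- by have := cong_meet Htheta tx (cong_refl y); rewrite meet0x meet_r.
- by have := cong_join Htheta tx ty; rewrite join0x.
Qed.

Lemma cong_bot_top_total : theta (\bot, \top) -> theta = [set: L * L].
Proof.
move=> t01; apply/seteqP; split=> // -[x y] _.
have bot_class z : theta (\bot, z).
  exact: (ideal_down cong_class_bot_ideal) t01 (lex1 z).
have [_ sym trans] := cong_equiv Htheta.
exact: trans (sym _ _ (bot_class x)) (bot_class y).
Qed.

End LatticeCongruence.

Section WDCongruence.
Local Open Scope order_scope.
Context d (L : wdLatticeType d) (theta : set (L * L)).
Hypothesis Htheta : wd_congruence theta.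
Implicit Types x y : L.

Let F := cong_class theta \top.
Let I := cong_class theta \bot.

Lemma cong_top_dcompl x : F x -> I (x^Δ).
Proof. by move=> /(wd_cong_dcompl Htheta); rewrite dcompl1. Qed.

Lemma cong_top_ncompl x : F x -> I (x^∇).
Proof. by move=> /(wd_cong_ncompl Htheta); rewrite ncompl1. Qed.

Lemma cong_bot_dcompl x : I x -> F (x^Δ).
Proof. by move=> /(wd_cong_dcompl Htheta); rewrite dcompl0. Qed.

Lemma cong_bot_ncompl x : I x -> F (x^∇).
Proof. by move=> /(wd_cong_ncompl Htheta); rewrite ncompl0. Qed.

Lemma cong_class_top_normal : normal_filter F.
Proof.
split; first exact/cong_class_top_filter/(wd_cong_lattice Htheta).
by move=> x /cong_top_dcompl /cong_bot_ncompl.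
Qed.

Lemma cong_class_bot_normal : normal_ideal I.
Proof.
split; first exact/cong_class_bot_ideal/(wd_cong_lattice Htheta).
by move=> x /cong_bot_ncompl /cong_top_dcompl.
Qed.

(** Each [x] in the class of [\top] is above [(x^Δ)^Δ], so [x^Δ] is a witness
    for membership in [Psi]. *)
Lemma Psi_cong_class : Psi I = F.
Proof.
apply/seteqP; split=> z.
  case=> x Ix; have [filterF _] := cong_class_top_normal.
  exact: (filter_up filterF (cong_bot_dcompl Ix)).
by move=> Fz; exists (z^Δ); [exact: cong_top_dcompl|exact: dcomplK_le].
Qed.

Lemma Phi_cong_class : Phi F = I.
Proof.
apply/seteqP; split=> z.
  case=> x Fx; have [idealI _] := cong_class_bot_normal.
  exact: (ideal_down idealI (cong_top_ncompl Fx)).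
by move=> Iz; exists (z^∇); [exact: cong_bot_ncompl|exact: ncomplK_ge].
Qed.

Lemma cong_class_trivial : F = [set \top] <-> I = [set \bot].
Proof.
by split=> E; [rewrite -Phi_cong_class E Phi_top
              |rewrite -Psi_cong_class E Psi_bot].
Qed.

(** A filter containing the dual skeleton elements of [F] contains [x^Δ^Δ], hence
    [x], for every [x] in [F]. *)
Lemma cong_class_top_gen :
  F = gen_normal_filter (F `&` dual_skeleton L)%classic.
Proof.
apply/seteqP; split=> x.
  move=> Fx N [[filterN _] GN].
  apply: (filter_up filterN) (dcomplK_le x); apply: GN; split.
    exact/cong_bot_dcompl/cong_top_dcompl.
  exact: dcomplKK.
apply; split; first exact: cong_class_top_normal.
by move=> y [].
Qed.

Lemma cong_class_bot_two_skeleton :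
  skeleton L = [set \bot; \top] ->
  theta = [set: L * L] \/ I = [set \bot].
Proof.
move=> skel2; case: (pselect (theta (\bot, \top))) => [t01|nt01].
  by left; apply: cong_bot_top_total t01; exact: wd_cong_lattice.
right; apply/seteqP; split=> x; last first.
  by move=> ->; exact: cong_refl (wd_cong_lattice Htheta) _.
move=> Ix; have Ixx : I (x^∇^∇) by exact/cong_top_ncompl/cong_bot_ncompl.
have : skeleton L (x^∇^∇) by exact: ncomplKK.
rewrite skel2 => -[] xxE; last by case: nt01; rewrite -xxE.
by apply/eqP; rewrite -lex0 -xxE; exact: ncomplK_ge.
Qed.

Lemma skel_restr_congruence : ortho_congruence (skel_restr theta).
Proof.
have [[[tr ts tt] tI tU] tD tN] := Htheta.
split=> [|x x' xx']; last exact: tN.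
split=> [|x y x' y' xx' yy'|x y x' y' xx' yy'].
- split=> [x|x y|x y z]; [exact: tr|exact: ts|exact: tt].
- exact: tI.
- by apply/tN/tI; apply: tN.
Qed.

Lemma dskel_restr_congruence : ortho_congruence (dskel_restr theta).
Proof.
have [[[tr ts tt] tI tU] tD tN] := Htheta.
split=> [|x x' xx']; last exact: tD.
split=> [|x y x' y' xx' yy'|x y x' y' xx' yy'].
- split=> [x|x y|x y z]; [exact: tr|exact: ts|exact: tt].
- by apply/tD/tU; apply: tD.
- exact: tU.
Qed.

End WDCongruence.

Theorem proposition13 (d : Order.disp_t) (L : wdLatticeType d)
    (theta : set (L * L)) (Htheta : wd_congruence theta) :
  (let F := cong_class theta \top%O in
   let I := cong_class theta \bot%O in
   [/\ normal_filter F, normal_ideal I, Psi I = F & Phi F = I]) /\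
  (ortho_congruence (skel_restr theta) /\
   ortho_congruence (dskel_restr theta)) /\
  ((theta (\bot%O, \top%O) -> theta = [set: L * L]) /\
   (skeleton L = [set \bot%O; \top%O] ->
    dual_skeleton L = [set \bot%O; \top%O] ->
    theta = [set: L * L] \/
    (cong_class theta \bot%O = [set \bot%O] /\
     cong_class theta \top%O = [set \top%O]))) /\
  (let G := cong_class theta \top%O `&` dual_skeleton L in
   cong_class theta \top%O = gen_normal_filter G) /\
  (cong_class theta \top%O = [set \top%O] <->
   cong_class theta \bot%O = [set \bot%O]).
Proof.
split.
  split; [exact: cong_class_top_normal|exact: cong_class_bot_normal
         |exact: Psi_cong_class|exact: Phi_cong_class].
split.
  by split; [exact: skel_restr_congruence|exact: dskel_restr_congruence].
split; last by split; [exact: cong_class_top_gen|exact: cong_class_trivial].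
split; first exact/cong_bot_top_total/wd_cong_lattice.
move=> skel2 _; have [|bot_trivial] := cong_class_bot_two_skeleton Htheta skel2.
  by left.
by right; split; last exact/(cong_class_trivial Htheta).
Qed.
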